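(* Let $q>2$ be a prime power and consider the 2-user broadcast channel over $\mathbb F_q$ with inputs $X_1,X_2\in\mathbb F_q$, in which at each channel use a coefficient $G$ uniform on $\mathbb F_q^\times$ is drawn, independent of the inputs and i.i.d. across uses, Rx-1 observes $\overline Y_1=(X_1,X_2)$ and Rx-2 observes $\overline Y_2=(GX_1+X_2,\,G)$ (a physically degraded and semi-deterministic BC). Then $$\max\{R_2:(\log_2 q,R_2)\in\mathcal C^{\mathrm{NS}}\}=\log_2 q,\qquad \max\{R_2:(\log_2 q,R_2)\in\mathcal C\}=\tfrac12\log_2 q,$$ where $\mathcal C^{\mathrm{NS}}$ and $\mathcal C$ are the capacity regions of this channel with and without NS-assistance.
   Context: Coding framework: messages $W_1,W_2$ independent and uniform on finite sets $\mathcal M_1,\mathcal M_2$; the transmitter controls $(X_1,X_2)$. Classical scheme: stochastic encoder from messages to the $n$ channel inputs and stochastic decoders $\hat W_k=\psi_k(\overline Y_k^{[n]})$. A $\kappa$-partite NS box is a conditional pmf of outputs given inputs (finite output alphabets) such that for every subset of parties the marginal of their outputs depends only on their inputs. NS-assisted scheme: a 3-partite NS box where the transmitter inputs $(W_1,W_2)$ and obtains the channel input sequence as output, and Rx-$k$ inputs $\overline Y_k^{[n]}$ and obtains $\hat W_k$; joint law = $\frac{1}{|\mathcal M_1||\mathcal M_2|}\times$ box distribution $\times$ channel law. Rate pairs are achievable if there is a sequence of schemes with vanishing $\max_k\Pr(\hat W_k\ne W_k)$ and $\lim_n\frac1n\log_2|\mathcal M_k^{(n)}|\ge R_k$; capacity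 region = closure of achievable pairs. *)

(* Defs.v *)
From HB Require Import structures.
From mathcomp Require Import all_boot all_order all_algebra.
From mathcomp Require Import all_classical all_reals all_analysis.
Set Implicit Arguments. Unset Strict Implicit. Unset Printing Implicit Defensive.
Import Order.TTheory GRing.Theory Num.Theory.
Import numFieldNormedType.Exports.
Local Open Scope classical_set_scope.
Local Open Scope ring_scope.

Section NSBox.
Variable R : realType.
Variables A1 A2 A3 B1 B2 B3 : finType.

Definition is_cond_pmf (P : A1 -> A2 -> A3 -> B1 -> B2 -> B3 -> R) : Prop :=
  (forall a1 a2 a3 b1 b2 b3, 0 <= P a1 a2 a3 b1 b2 b3) /\
  (forall a1 a2 a3, \sum_(b1 : B1) \sum_(b2 : B2) \sum_(b3 : B3) P a1 a2 a3 b1 b2 b3 = 1).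

Definition is_NS (P : A1 -> A2 -> A3 -> B1 -> B2 -> B3 -> R) : Prop :=
  (forall a1 a2 a3 a3' b1 b2,
     \sum_(b3 : B3) P a1 a2 a3 b1 b2 b3 = \sum_(b3 : B3) P a1 a2 a3' b1 b2 b3) /\
  (forall a1 a2 a2' a3 b1 b3,
     \sum_(b2 : B2) P a1 a2 a3 b1 b2 b3 = \sum_(b2 : B2) P a1 a2' a3 b1 b2 b3) /\
  (forall a1 a1' a2 a3 b2 b3,
     \sum_(b1 : B1) P a1 a2 a3 b1 b2 b3 = \sum_(b1 : B1) P a1' a2 a3 b1 b2 b3) /\
  (forall a1 a2 a2' a3 a3' b1,
     \sum_(b2 : B2) \sum_(b3 : B3) P a1 a2 a3 b1 b2 b3
     = \sum_(b2 : B2) \sum_(b3 : B3) P a1 a2' a3' b1 b2 b3) /\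
  (forall a1 a1' a2 a3 a3' b2,
     \sum_(b1 : B1) \sum_(b3 : B3) P a1 a2 a3 b1 b2 b3
     = \sum_(b1 : B1) \sum_(b3 : B3) P a1' a2 a3' b1 b2 b3) /\
  (forall a1 a1' a2 a2' a3 b3,
     \sum_(b1 : B1) \sum_(b2 : B2) P a1 a2 a3 b1 b2 b3
     = \sum_(b1 : B1) \sum_(b2 : B2) P a1' a2' a3 b1 b2 b3).

Definition NSbox (P : A1 -> A2 -> A3 -> B1 -> B2 -> B3 -> R) : Prop :=
  is_cond_pmf P /\ is_NS P.
End NSBox.

Section Kernel.
Variable R : realType.
Variables A B : finType.
Definition is_kernel (K : A -> B -> R) : Prop :=
  (forall a b, 0 <= K a b) /\ (forall a, \sum_(b : B) K a b = 1).
End Kernel.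

Definition log2 {R : realType} (x : R) : R := ln x / ln 2.

Section Channel.
Variable R : realType.
Variable F : finFieldType.

Definition Fx := {g : F | g != 0}.
(** per-use input (X1,X2), Rx-1 output Y1 = (X1,X2), Rx-2 output (G X1 + X2, G) *)
Definition Xin := (F * F)%type.
Definition Yout1 := (F * F)%type.
Definition Yout2 := (F * Fx)%type.

Definition chan (y1 : Yout1) (y2 : Yout2) (x : Xin) : R :=
  if (y1 == x) && (y2.1 == val y2.2 * x.1 + x.2)
  then (#|{: Fx}|%:R)^-1 else 0.

Definition chan_n (n : nat) (y1 : {ffun 'I_n -> Yout1}) (y2 : {ffun 'I_n -> Yout2})
  (x : {ffun 'I_n -> Xin}) : R :=
  \prod_(i < n) chan (y1 i) (y2 i) (x i).

(** box type of a scheme of blocklength n with message sets 'I_m1, 'I_m2: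
    inputs (Tx: (W1,W2), Rx-1: Y1^n, Rx-2: Y2^n),
    outputs (Tx: X^n, Rx-1: hat W1, Rx-2: hat W2). *)
Definition boxT (n m1 m2 : nat) :=
  ('I_m1 * 'I_m2)%type -> {ffun 'I_n -> Yout1} -> {ffun 'I_n -> Yout2} ->
  {ffun 'I_n -> Xin} -> 'I_m1 -> 'I_m2 -> R.

Definition err1 n m1 m2 (P : boxT n m1 m2) : R :=
  (m1%:R * m2%:R)^-1 *
  \sum_(w : 'I_m1 * 'I_m2) \sum_(y1 : {ffun 'I_n -> Yout1}) \sum_(y2 : {ffun 'I_n -> Yout2})
  \sum_(x : {ffun 'I_n -> Xin}) \sum_(v1 : 'I_m1) \sum_(v2 : 'I_m2)
    (if v1 != w.1 then P w y1 y2 x v1 v2 * chan_n y1 y2 x else 0).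

Definition err2 n m1 m2 (P : boxT n m1 m2) : R :=
  (m1%:R * m2%:R)^-1 *
  \sum_(w : 'I_m1 * 'I_m2) \sum_(y1 : {ffun 'I_n -> Yout1}) \sum_(y2 : {ffun 'I_n -> Yout2})
  \sum_(x : {ffun 'I_n -> Xin}) \sum_(v1 : 'I_m1) \sum_(v2 : 'I_m2)
    (if v2 != w.2 then P w y1 y2 x v1 v2 * chan_n y1 y2 x else 0).

(** the box of a classical scheme: stochastic encoder and stochastic decoders,
    with independent local randomness *)
Definition classical_box n m1 m2
  (E : ('I_m1 * 'I_m2)%type -> {ffun 'I_n -> Xin} -> R)
  (D1 : {ffun 'I_n -> Yout1} -> 'I_m1 -> R)
  (D2 : {ffun 'I_n -> Yout2} -> 'I_m2 -> R) : boxT n m1 m2 :=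
  fun w y1 y2 x v1 v2 => E w x * D1 y1 v1 * D2 y2 v2.

Definition good_sequence (m1 m2 : nat -> nat) (P : forall n, boxT n (m1 n) (m2 n))
  (r : R * R) : Prop :=
  (forall n, (0 < m1 n)%N /\ (0 < m2 n)%N) /\
  ((fun n => Num.max (err1 (P n)) (err2 (P n))) @ \oo --> (0 : R)) /\
  (exists l1 : R, (fun n => (n%:R)^-1 * log2 ((m1 n)%:R : R)) @ \oo --> l1 /\ r.1 <= l1) /\
  (exists l2 : R, (fun n => (n%:R)^-1 * log2 ((m2 n)%:R : R)) @ \oo --> l2 /\ r.2 <= l2).

Definition achievable_NS (r : R * R) : Prop :=
  exists (m1 m2 : nat -> nat) (P : forall n, boxT n (m1 n) (m2 n)),
    (forall n, NSbox (P n)) /\ good_sequence P r.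

Definition achievable_classical (r : R * R) : Prop :=
  exists (m1 m2 : nat -> nat)
    (E : forall n, ('I_(m1 n) * 'I_(m2 n))%type -> {ffun 'I_n -> Xin} -> R)
    (D1 : forall n, {ffun 'I_n -> Yout1} -> 'I_(m1 n) -> R)
    (D2 : forall n, {ffun 'I_n -> Yout2} -> 'I_(m2 n) -> R),
    (forall n, is_kernel (E n) /\ is_kernel (D1 n) /\ is_kernel (D2 n)) /\
    good_sequence (fun n => classical_box (E n) (D1 n) (D2 n)) r.

Definition cap_region_NS : set (R * R) := closure [set r | achievable_NS r].
Definition cap_region : set (R * R) := closure [set r | achievable_classical r].

End Channel.

Definition is_max_of {R : realType} (S : set R) (m : R) : Prop :=
  S m /\ (forall x, S x -> x <= m).

(* Main.v *)
(** Write q = #|F|, and let e1, e2 be the two error probabilities.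

    With NS assistance, X is uniform and the box outputs v1 = w1 + (y1.1 - X1)
    and v2 = w2 + (y2 - (g X1 + X2)); since (X1, g X1 + X2) is a bijective
    function of X, the pair (v1, v2) is uniform, whence no-signalling, and both
    corrections vanish when y1, y2 come from X.  Conversely the output
    distribution of Rx-2 does not depend on W2, so (1 - e2) m2 <= q^n.

    Without assistance, time sharing between sending W1 on both symbols and
    sending W2 on X2 with X1 = 0 reaches (log q, log q / 2).  Conversely, fix
    a <> 0, 1 (this needs q > 2).  The outputs of Rx-2 under the coefficients g
    and a g determine X, so the input words carrying a given w2, of which there
    are about m1, number at most the product of the numbers of outputs decoded
    to w2 under g and under a g.  By AM-GM, summing over w2 gives
    (1 - e1 - 2 e2) m2 sqrt(m1) <= q^n, that is R2 + R1 / 2 <= log q. *)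

Require Import Defs.
From HB Require Import structures.
From mathcomp Require Import all_boot all_order all_algebra.
From mathcomp Require Import all_classical all_reals all_analysis.
From mathcomp Require Import ring lra.
Import Order.TTheory GRing.Theory Num.Theory.
Import numFieldNormedType.Exports.
Set Implicit Arguments. Unset Strict Implicit. Unset Printing Implicit Defensive.
Local Open Scope classical_set_scope.
Local Open Scope ring_scope.

(** * Finite sums *)

Lemma sum_if_eq (V : nmodType) (I : finType) (i0 : I) (c : V) :
  \sum_(i : I) (if i == i0 then c else 0) = c.
Proof. by rewrite -big_mkcond big_pred1_eq. Qed.

Lemma ler_sum_inj (R : realDomainType) (S T : finType) (f : S -> T) (h : T -> R) :
  injective f -> (forall t, 0 <= h t) -> \sum_s h (f s) <= \sum_t h t.
Proof.
move=> f_inj h0; rewrite [leRHS](bigID (mem (f @: predT)))/=.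
rewrite big_imset/=; last by move=> ? ? _ _ /f_inj.
by rewrite lerDl sumr_ge0.
Qed.

(** * The law of [n] channel uses and the success probabilities *)

Section ChannelLaw.
Variables (R : realType) (F : finFieldType).

(** Splitting the output words of Rx-2 into coefficients and values lets sums over outputs be
    reindexed by the coefficients alone. *)
Definition coef n (y2 : {ffun 'I_n -> Yout2 F}) : {ffun 'I_n -> Fx F} :=
  [ffun i => (y2 i).2].

Definition obs2 n (y : {ffun 'I_n -> F}) (g : {ffun 'I_n -> Fx F}) :
  {ffun 'I_n -> Yout2 F} := [ffun i => (y i, g i)].

Definition comb n (g : {ffun 'I_n -> Fx F}) (x : {ffun 'I_n -> Xin F}) :
  {ffun 'I_n -> F} := [ffun i => val (g i) * (x i).1 + (x i).2].

Definition cFx : R := (#|{: Fx F}|%:R)^-1.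

Lemma card_Fx_gt0 : (0 < #|{: Fx F}|)%N.
Proof. by apply/card_gt0P; exists (exist _ 1 (oner_neq0 F)). Qed.

Lemma cFx_gt0 : 0 < cFx.
Proof. by rewrite invr_gt0 ltr0n card_Fx_gt0. Qed.

Lemma sum_coef n : \sum_(g : {ffun 'I_n -> Fx F}) cFx ^+ n = 1.
Proof.
rewrite sumr_const card_ffun card_ord -[RHS](expr1n R n).
rewrite -mulr_natr natrX -exprMn mulVf// pnatr_eq0 -lt0n; exact: card_Fx_gt0.
Qed.

Lemma chan_nE n y1 y2 (x : {ffun 'I_n -> Xin F}) :
  chan_n R y1 y2 x =
  if (y1 == x) && (y2 == obs2 (comb (coef y2) x) (coef y2)) then cFx ^+ n else 0.
Proof.
rewrite /chan_n; case: ifPn => [/andP[/eqP -> /eqP y2E]|].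
  rewrite (eq_bigr (fun=> cFx)) ?prodr_const ?card_ord// => i _.
  by rewrite /chan eqxx y2E !ffunE/= eqxx.
move=> neq; apply/eqP/prodf_eq0.
have [i ci] : exists i, ~~ ((y1 i == x i) &&
    ((y2 i).1 == val (y2 i).2 * (x i).1 + (x i).2)).
  apply/existsP; rewrite -negb_forall; apply: contra neq => /forallP all_i.
  apply/andP; split; apply/eqP/ffunP => i; have /andP[/eqP e1 /eqP e2] := all_i i => //.
  by rewrite !ffunE -e2; case: (y2 i).
by exists i => //; rewrite /chan (negPf ci).
Qed.

(** Both outputs are functions of the input and the coefficients, so each pair [(x, g)] leaves one
    term, and all coefficient words have the same weight. *)
Lemma sum_chan_n n (H : {ffun 'I_n -> Yout1 F} -> {ffun 'I_n -> Yout2 F} ->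
    {ffun 'I_n -> Xin F} -> R) :
  \sum_y1 \sum_y2 \sum_x H y1 y2 x * chan_n R y1 y2 x =
  \sum_x \sum_g cFx ^+ n * H x (obs2 (comb g x) g) x.
Proof.
under eq_bigr do rewrite exchange_big/=.
rewrite exchange_big/=; apply: eq_bigr => x _.
rewrite (bigD1 x)//= [X in _ + X]big1 ?addr0 => [|y1 neq]; last first.
  by rewrite big1// => y2 _; rewrite chan_nE (negPf neq) mulr0.
rewrite (eq_bigr (fun y2 => if y2 == obs2 (comb (coef y2) x) (coef y2)
   then cFx ^+ n * H x y2 x else 0)); last first.
  by move=> y2 _; rewrite chan_nE eqxx/=; case: ifP; rewrite ?mulr0// mulrC.
rewrite -big_mkcond (reindex_onto (fun g => obs2 (comb g x) g) (@coef n))/=; last first.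
  by move=> y2 /eqP <-.
apply: eq_bigl => g.
have -> : coef (obs2 (comb g x) g) = g by apply/ffunP => i; rewrite !ffunE.
by rewrite !eqxx.
Qed.

(** No signalling from the receivers to the transmitter: the law [p] of the channel input ignores
    [y1] and [y2]. This gives the joint law total mass 1, and both kinds of scheme have it. *)
Definition input_marginal n m1 m2 (P : boxT R F n m1 m2) p :=
  (forall w y1 y2 x, \sum_v1 \sum_v2 P w y1 y2 x v1 v2 = p w x) /\
  (forall w, \sum_x p w x = 1).

Lemma sum_input_marginal n m1 m2 (P : boxT R F n m1 m2) p :
  (0 < m1)%N -> (0 < m2)%N -> input_marginal P p ->
  (m1%:R * m2%:R)^-1 * \sum_w \sum_x \sum_g cFx ^+ n *
     (\sum_v1 \sum_v2 P w x (obs2 (comb g x) g) x v1 v2) = 1.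
Proof.
move=> m1_gt0 m2_gt0 [Pp p1].
rewrite (eq_bigr (fun=> 1)); last first.
  move=> w _; rewrite -(p1 w); apply: eq_bigr => x _.
  under eq_bigr do rewrite Pp.
  by rewrite -mulr_suml sum_coef mul1r.
by rewrite sumr_const card_prod !card_ord natrM mulVf// mulf_neq0 ?pnatr_eq0 -?lt0n.
Qed.

(** The error mass is subtracted from the total mass 1, so only the terms with [v1 = w.1] remain. *)
Lemma err1_compl n m1 m2 (P : boxT R F n m1 m2) p :
  (0 < m1)%N -> (0 < m2)%N -> input_marginal P p ->
  1 - err1 P = (m1%:R * m2%:R)^-1 * \sum_w \sum_x \sum_g cFx ^+ n *
     (\sum_v2 P w x (obs2 (comb g x) g) x w.1 v2).
Proof.
move=> m1_gt0 m2_gt0 Pp; rewrite -[X in X - _](sum_input_marginal m1_gt0 m2_gt0 Pp) /err1 -mulrBr.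
congr (_ * _); rewrite -sumrB; apply: eq_bigr => w _.
rewrite [X in _ - X](_ : _ = \sum_x \sum_g cFx ^+ n *
   \sum_v1 \sum_v2 if v1 != w.1 then P w x (obs2 (comb g x) g) x v1 v2 else 0).
  rewrite -sumrB; apply: eq_bigr => x _; rewrite -sumrB; apply: eq_bigr => g _.
  rewrite -mulrBr -sumrB (bigD1 w.1)//= eqxx/= [X in _ - X]big1// subr0.
  rewrite [X in _ + X]big1 ?addr0// => v1 ->; exact: subrr.
rewrite -(sum_chan_n (fun y1 y2 x =>
  \sum_v1 \sum_v2 if v1 != w.1 then P w y1 y2 x v1 v2 else 0)).
do 3 (apply: eq_bigr => ? _).
rewrite mulr_suml; apply: eq_bigr => v1 _; rewrite mulr_suml; apply: eq_bigr => v2 _.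
by case: ifP; rewrite ?mul0r.
Qed.

Lemma err2_compl n m1 m2 (P : boxT R F n m1 m2) p :
  (0 < m1)%N -> (0 < m2)%N -> input_marginal P p ->
  1 - err2 P = (m1%:R * m2%:R)^-1 * \sum_w \sum_x \sum_g cFx ^+ n *
     (\sum_v1 P w x (obs2 (comb g x) g) x v1 w.2).
Proof.
move=> m1_gt0 m2_gt0 Pp; rewrite -[X in X - _](sum_input_marginal m1_gt0 m2_gt0 Pp) /err2 -mulrBr.
congr (_ * _); rewrite -sumrB; apply: eq_bigr => w _.
rewrite [X in _ - X](_ : _ = \sum_x \sum_g cFx ^+ n *
   \sum_v1 \sum_v2 if v2 != w.2 then P w x (obs2 (comb g x) g) x v1 v2 else 0).
  rewrite -sumrB; apply: eq_bigr => x _; rewrite -sumrB; apply: eq_bigr => g _.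
  rewrite -mulrBr -sumrB; congr (_ * _); apply: eq_bigr => v1 _.
  rewrite -sumrB (bigD1 w.2)//= eqxx/= subr0.
  rewrite [X in _ + X]big1 ?addr0// => v2 ->; exact: subrr.
rewrite -(sum_chan_n (fun y1 y2 x =>
  \sum_v1 \sum_v2 if v2 != w.2 then P w y1 y2 x v1 v2 else 0)).
do 3 (apply: eq_bigr => ? _).
rewrite mulr_suml; apply: eq_bigr => v1 _; rewrite mulr_suml; apply: eq_bigr => v2 _.
by case: ifP; rewrite ?mul0r.
Qed.

End ChannelLaw.


(** * Converse bounds at a fixed blocklength *)

Section Converse.
Variables (R : realType) (F : finFieldType).

(** By no-signalling, the law of the guess of Rx-2 given [y2] is independent of the messages. Its
    total over the guesses is 1 for each [y2], and each coefficient word comes with [q^n] values of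
    [y2]. *)
Lemma NS_message_bound n m1 m2 (P : boxT R F n m1 m2) :
  (0 < m1)%N -> (0 < m2)%N -> NSbox P ->
  (1 - err2 P) * m2%:R <= #|F|%:R ^+ n.
Proof.
move=> m1_gt0 m2_gt0 [[P0 P1] [_ [ns2 [_ [ns23 [_ ns12]]]]]].
(* Arbitrary reference inputs, put in place of those on which a marginal does not depend. *)
pose y01 : {ffun 'I_n -> Yout1 F} := [ffun=> (0, 0)].
pose y02 := obs2 [ffun=> 0 : F] [ffun i : 'I_n => exist _ 1 (oner_neq0 F) : Fx F].
have Pp : input_marginal P (fun w x => \sum_v1 \sum_v2 P w y01 y02 x v1 v2).
  by split=> [w y1 y2 x|w]; [exact: ns23|exact: P1].
pose w0 : 'I_m1 * 'I_m2 := (Ordinal m1_gt0, Ordinal m2_gt0).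
pose Q w y2 x v2 := \sum_v1 P w y01 y2 x v1 v2.
have Q0 w y2 x v2 : 0 <= Q w y2 x v2 by apply: sumr_ge0.
pose D y2 v2 := \sum_x Q w0 y2 x v2.
have QE w y2 v2 : \sum_x Q w y2 x v2 = D y2 v2 by exact: ns12.
have D1 y2 : \sum_v2 D y2 v2 = 1.
  rewrite /D exchange_big/= -(P1 w0 y01 y2); apply: eq_bigr => x _.
  by rewrite exchange_big.
have c_gt0 := cFx_gt0 R F.
have le_sum : \sum_w \sum_x \sum_g cFx R F ^+ n *
    (\sum_v1 P w x (obs2 (comb g x) g) x v1 w.2) <= m1%:R * #|F|%:R ^+ n.
  (* The sum over [g] covers only the [y2] compatible with [x]. Extending it to all [y2] cuts this
     link, and [x] can then be summed out. *)
  apply: (@le_trans _ _ (\sum_(w : 'I_m1 * 'I_m2) cFx R F ^+ n * \sum_y2 D y2 w.2)).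
    apply: ler_sum => w _.
    have -> : \sum_y2 D y2 w.2 = \sum_x \sum_y2 Q w y2 x w.2.
      by rewrite [RHS]exchange_big; apply: eq_bigr => y2 _; rewrite /= QE.
    rewrite mulr_sumr; apply: ler_sum => x _.
    rewrite -mulr_sumr ler_pM2l ?exprn_gt0//.
    under eq_bigr do rewrite (ns2 _ _ y01).
    apply: (@ler_sum_inj R _ _ (fun g => obs2 (comb g x) g) (fun y2 => Q w y2 x w.2)) => //.
    move=> g g' /ffunP gg'; apply/ffunP => i.
    by have := gg' i; rewrite !ffunE => -[].
  rewrite -mulr_sumr -(pair_bigA _ (fun _ w2 => \sum_y2 D y2 w2))/=.
  under eq_bigr do (rewrite exchange_big/=; under eq_bigr do rewrite D1).
  rewrite !sumr_const card_ord card_ffun card_prod card_ord -[X in _ * X]mulr_natl.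
  rewrite natrX natrM exprMn mulrCA ler_pM2l ?ltr0n//.
  rewrite mulrCA -exprMn /cFx mulVf ?expr1n ?mulr1//.
  by rewrite pnatr_eq0 -lt0n; exact: card_Fx_gt0.
rewrite (err2_compl m1_gt0 m2_gt0 Pp).
have m1R : (0 : R) < m1%:R by rewrite ltr0n.
have m2R : (0 : R) < m2%:R by rewrite ltr0n.
rewrite mulrC mulrA invfM mulrCA mulfV ?gt_eqF// mulr1 ler_pdivrMl//.
Qed.

(** For indicators this counts points of a set of size at most [m] that are sent injectively into a
    product of sets of sizes [S] and [S']: at most [min(m, S S')], hence at most [sqrt(m S S')]. The
    weighted form allows for stochastic encoders and decoders. *)
Lemma sum_prod_le_sqrt (X Y : finType) (f : X -> R) (d d' : Y -> R) (u u' : X -> Y) (m : R) :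
  0 < m -> (forall x, 0 <= f x <= 1) -> \sum_x f x <= m ->
  (forall y, 0 <= d y <= 1) -> (forall y, 0 <= d' y <= 1) ->
  injective (fun x => (u x, u' x)) ->
  \sum_x f x * d (u x) * d' (u' x) <= Num.sqrt m * ((\sum_y d y + \sum_y d' y) / 2).
Proof.
move=> m_gt0 f01 fm d01 d'01 uu'_inj.
have d0 y : 0 <= d y by case/andP: (d01 y).
have d'0 y : 0 <= d' y by case/andP: (d'01 y).
set S := \sum_y d y; set S' := \sum_y d' y.
have S0 : 0 <= S by exact: sumr_ge0.
have S'0 : 0 <= S' by exact: sumr_ge0.
(* When both sums vanish, the parameter [t] below would be zero, but then so is every term on the
   left. *)
have [SS'_le0|SS'_gt0] := leP (S + S') 0.
  have dE y : d y = 0.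
    apply/eqP; rewrite eq_le d0 andbT.
    have: \sum_(z | z != y) d z >= 0 by exact: sumr_ge0.
    by move: SS'_le0; rewrite /S (bigD1 y)//=; lra.
  rewrite big1 => [|x _]; last by rewrite dE mulr0 mul0r.
  by rewrite mulr_ge0 ?sqrtr_ge0// divr_ge0 ?addr_ge0.
set s := Num.sqrt m.
have s_gt0 : 0 < s by rewrite sqrtr_gt0.
have ss : s * s = m by rewrite -expr2 sqr_sqrtr// ltW.
pose t := (S + S') / 2 / s.
have t_gt0 : 0 < t by rewrite !divr_gt0.
(* AM-GM: f p <= sqrt (f p) <= (t f + p / t) / 2 for f, p in [0, 1], and t is
   chosen to balance the two sums. *)
have amgm x : f x * d (u x) * d' (u' x) <=
    (t * f x + d (u x) * d' (u' x) / t) / 2.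
  have /andP[f0 f1] := f01 x.
  have [/andP[a0 a1] /andP[b0 b1]] := (d01 (u x), d'01 (u' x)).
  rewrite -mulrA; set p := d (u x) * d' (u' x).
  have p0 : 0 <= p by exact: mulr_ge0.
  have p1 : p <= 1 by rewrite -[1]mulr1; apply: ler_pM.
  rewrite ler_pdivlMr// -(ler_pM2l t_gt0).
  have -> : t * (t * f x + p / t) = t * t * f x + p by field; rewrite gt_eqF.
  have : 0 <= (t * f x - p) ^+ 2 by exact: sqr_ge0.
  have : p * p <= p by rewrite ler_piMl.
  have : t * t * (f x * f x) <= t * t * f x.
    by apply: ler_wpM2l; [exact/ltW/mulr_gt0|rewrite ler_piMl].
  by rewrite expr2; nra.
apply: (le_trans (ler_sum _ (fun x _ => amgm x))).
rewrite -mulr_suml big_split/= -mulr_sumr -mulr_suml.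
have le_SS' : \sum_x d (u x) * d' (u' x) <= S * S'.
  rewrite mulr_suml; under [leRHS]eq_bigr do rewrite mulr_sumr.
  rewrite pair_bigA/=.
  apply: (@ler_sum_inj R _ _ _ (fun y : Y * Y => d y.1 * d' y.2) uu'_inj) => y.
  exact: mulr_ge0.
have tm : t * m = s * ((S + S') / 2).
  by rewrite -ss /t mulrA divfK ?gt_eqF// mulrC.
(* AM-GM for the two sums: [S S'] is at most [((S + S') / 2)^2], which is [t m t]. *)
have le_tm : (\sum_x d (u x) * d' (u' x)) / t <= t * m.
  rewrite ler_pdivrMr//; apply: (le_trans le_SS').
  have -> : t * m * t = ((S + S') / 2) ^+ 2.
    by rewrite -ss /t; field; rewrite gt_eqF.
  by have := sqr_ge0 (S - S'); rewrite !expr2; nra.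
rewrite ler_pdivrMr// -tm.
have : t * \sum_x f x <= t * m by rewrite ler_pM2l.
lra.
Qed.

(** Each letter gives two linear equations in [(X1, X2)], with nonzero determinant [g i - g' i]. *)
Lemma comb_pair_inj n (g g' : {ffun 'I_n -> Fx F}) : (forall i, g i != g' i) ->
  injective (fun x => (comb g x, comb g' x)).
Proof.
move=> neq x z [/ffunP e /ffunP e']; apply/ffunP => i.
have := e i; have := e' i; rewrite !ffunE => h' h.
have gg' : val (g i) - val (g' i) != 0 by rewrite subr_eq0; exact: neq.
have e1 : (x i).1 = (z i).1.
  apply: (mulfI gg'); rewrite !mulrBl.
  have -> : val (g i) * (x i).1 - val (g' i) * (x i).1 =
    (val (g i) * (x i).1 + (x i).2) - (val (g' i) * (x i).1 + (x i).2) by ring.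
  by rewrite h h'; ring.
move: h; rewrite e1 => /addrI e2.
by move: e1 e2; case: (x i) => ? ?; case: (z i) => ? ? /= -> ->.
Qed.

(** This is where [q > 2] enters: over the field with two elements, 1 is the only coefficient. *)
Lemma exists_neq01 : (2 < #|F|)%N -> exists a : Fx F, val a != 1.
Proof.
move=> q_gt2; have /subsetPn[a _] : ~~ (F \subset [:: 0; 1 : F]).
  apply: contraL q_gt2 => /subset_leq_card le; rewrite -leqNgt.
  exact: leq_trans le (card_size _).
by rewrite !inE negb_or => /andP[a0 a1]; exists (exist _ a a0).
Qed.

Definition Fx_mul (a b : Fx F) : Fx F :=
  exist _ (val a * val b) (mulf_neq0 (valP a) (valP b)).

(** Scaling permutes the coefficient words, so [scale a g] is uniform when [g] is; for [a] different
    from 1 the two words differ in every letter. *)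
Definition scale n a (g : {ffun 'I_n -> Fx F}) := [ffun i => Fx_mul a (g i)].

Lemma scale_inj n a : injective (@scale n a).
Proof.
move=> g g' /ffunP gg'; apply/ffunP => i; apply: val_inj.
by have := gg' i; rewrite !ffunE => -[] /(mulfI (valP a)).
Qed.

Lemma kernel_le1 (A B : finType) (K : A -> B -> R) a b : is_kernel K -> K a b <= 1.
Proof. by case=> K0 K1; rewrite -(K1 a) (bigD1 b)//= lerDl sumr_ge0. Qed.

Lemma classical_input_marginal n m1 m2
    (E : 'I_m1 * 'I_m2 -> {ffun 'I_n -> Xin F} -> R)
    (D1 : {ffun 'I_n -> Yout1 F} -> 'I_m1 -> R)
    (D2 : {ffun 'I_n -> Yout2 F} -> 'I_m2 -> R) :
  is_kernel E -> is_kernel D1 -> is_kernel D2 ->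
  input_marginal (classical_box E D1 D2) E.
Proof.
move=> [_ E1] [_ D11] [_ D21]; split=> [w y1 y2 x|]; last exact: E1.
rewrite /classical_box; under eq_bigr do rewrite -mulr_sumr D21 mulr1.
by rewrite -mulr_sumr D11 mulr1.
Qed.

(** [sum_prod_le_sqrt] is applied for each [w2], with [f w2 x] the weight, summed over [w1], with
    which [x] carries the pair and Rx-1 finds [w1]. Each output word has total decoding weight 1, so
    summing over [w2] yields [q^n]. *)
Lemma decode_bound n m1 m2 (E : 'I_m1 * 'I_m2 -> {ffun 'I_n -> Xin F} -> R)
    (D1 : {ffun 'I_n -> Yout1 F} -> 'I_m1 -> R)
    (D2 : {ffun 'I_n -> Yout2 F} -> 'I_m2 -> R) (g g' : {ffun 'I_n -> Fx F}) :
  (0 < m1)%N -> is_kernel E -> is_kernel D1 -> is_kernel D2 ->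
  (forall i, g i != g' i) ->
  \sum_w \sum_x E w x * D1 x w.1 * D2 (obs2 (comb g x) g) w.2 *
      D2 (obs2 (comb g' x) g') w.2
    <= Num.sqrt (m1%:R) * #|F|%:R ^+ n.
Proof.
move=> m1_gt0 kE kD1 kD2 gg'.
have [[E0 E1] [D10 D11] [D20 D21]] := And3 kE kD1 kD2.
pose f w2 x := \sum_w1 E (w1, w2) x * D1 x w1.
pose d g w2 y := D2 (obs2 y g) w2.
have dE h : \sum_w2 \sum_y d h w2 y = #|F|%:R ^+ n.
  rewrite exchange_big/=; rewrite (eq_bigr (fun=> 1)) => [|y _]; last exact: D21.
  by rewrite sumr_const card_ffun card_ord natrX.
pose H w1 w2 := \sum_x E (w1, w2) x * D1 x w1 *
  D2 (obs2 (comb g x) g) w2 * D2 (obs2 (comb g' x) g') w2.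
rewrite (eq_bigr (fun w => H w.1 w.2)); last by case.
rewrite -(pair_bigA _ H)/= /H exchange_big/=.
apply: (@le_trans _ _ (\sum_w2 Num.sqrt m1%:R *
    ((\sum_y d g w2 y + \sum_y d g' w2 y) / 2))); last first.
  rewrite -mulr_sumr -mulr_suml big_split/= !dE.
  by rewrite [X in X / 2](_ : _ = #|F|%:R ^+ n * 2) ?mulfK//; ring.
apply: ler_sum => w2 _; rewrite exchange_big/=.
have d01 h y : 0 <= d h w2 y <= 1 by apply/andP; split; [exact: D20|exact: (kernel_le1 _ _ kD2)].
have -> : \sum_x \sum_w1 E (w1, w2) x * D1 x w1 *
    D2 (obs2 (comb g x) g) w2 * D2 (obs2 (comb g' x) g') w2 =
    \sum_x f w2 x * d g w2 (comb g x) * d g' w2 (comb g' x).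
  by apply: eq_bigr => x _; rewrite !mulr_suml.
apply: sum_prod_le_sqrt => //.
- by rewrite ltr0n.
(* At most 1, because Rx-1 sees [x] itself and its guesses have total weight 1. *)
- move=> x; rewrite sumr_ge0 => [/=|? _]; last exact: mulr_ge0.
  rewrite -(D11 x); apply: ler_sum => w1 _; rewrite ler_piMl//.
  exact: (kernel_le1 _ _ kE).
(* At most [m1], because each pair [(w1, w2)] spreads mass 1 over the inputs. *)
- rewrite exchange_big/= -[leRHS]mulr1 mulr_natl -[in leRHS](card_ord m1) -sumr_const.
  apply: ler_sum => w1 _; rewrite -(E1 (w1, w2)); apply: ler_sum => x _.
  by rewrite ler_piMr// (kernel_le1 _ _ kD1).
- exact: comb_pair_inj.
Qed.

(** Let one input be observed under [g] and under [scale a g], both uniform. By the union bound,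
    Rx-1 and both decodings of Rx-2 are correct with probability at least [1 - e1 - 2 e2], and
    [decode_bound] limits that probability. *)
Lemma classical_message_bound n m1 m2
    (E : 'I_m1 * 'I_m2 -> {ffun 'I_n -> Xin F} -> R)
    (D1 : {ffun 'I_n -> Yout1 F} -> 'I_m1 -> R)
    (D2 : {ffun 'I_n -> Yout2 F} -> 'I_m2 -> R) :
  (2 < #|F|)%N -> (0 < m1)%N -> (0 < m2)%N ->
  is_kernel E -> is_kernel D1 -> is_kernel D2 ->
  (1 - err1 (classical_box E D1 D2) - 2 * err2 (classical_box E D1 D2)) *
    (m2%:R * Num.sqrt m1%:R) <= #|F|%:R ^+ n.
Proof.
move=> /exists_neq01[a a1] m1_gt0 m2_gt0 kE kD1 kD2.
have Pp := classical_input_marginal kE kD1 kD2.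
have [[E0 E1] [D10 D11] [D20 D21]] := And3 kE kD1 kD2.
have m1R : (0 : R) < m1%:R by rewrite ltr0n.
have m2R : (0 : R) < m2%:R by rewrite ltr0n.
have := sum_input_marginal m1_gt0 m2_gt0 Pp.
have := err1_compl m1_gt0 m2_gt0 Pp; have := err2_compl m1_gt0 m2_gt0 Pp.
set c := cFx R F; set e1 := err1 _; set e2 := err2 _; set N := m1%:R * m2%:R.
set A2 := \sum_w _; set A1 := \sum_w _; set A0 := \sum_w _ => h2 h1 h0.
have N_gt0 : 0 < N by exact: mulr_gt0.
have c_gt0 : 0 < c ^+ n by rewrite exprn_gt0// cFx_gt0.
have NV x : N * (N^-1 * x) = x by rewrite mulrA mulfV ?mul1r ?gt_eqF.
(* [A0] is the total mass, [A1] and [A2] the success masses, all before division by the number [N]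
   of message pairs. *)
have {}h0 : A0 = N by rewrite -[LHS]NV h0 mulr1.
have {}h1 : A1 = N * (1 - e1) by rewrite h1 NV.
have {}h2 : A2 = N * (1 - e2) by rewrite h2 NV.
have A0E : A0 = \sum_w \sum_x \sum_(g : {ffun 'I_n -> Fx F}) c ^+ n * E w x.
  by do 3 (apply: eq_bigr => ? _); rewrite Pp.1.
have A1E : A1 = \sum_w \sum_x \sum_(g : {ffun 'I_n -> Fx F}) c ^+ n * (E w x * D1 x w.1).
  do 3 (apply: eq_bigr => ? _); rewrite /classical_box.
  by rewrite -mulr_sumr D21 mulr1.
have A2E : A2 = \sum_w \sum_x \sum_g c ^+ n * (E w x * D2 (obs2 (comb g x) g) w.2).
  do 3 (apply: eq_bigr => ? _); rewrite /classical_box.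
  by rewrite -mulr_suml -mulr_sumr D11 mulr1.
have A2E' : A2 = \sum_w \sum_x \sum_g c ^+ n *
    (E w x * D2 (obs2 (comb (scale a g) x) (scale a g)) w.2).
  rewrite A2E; do 2 (apply: eq_bigr => ? _).
  by rewrite (reindex_inj (@scale_inj n a)).
pose G g := \sum_w \sum_x E w x * D1 x w.1 * D2 (obs2 (comb g x) g) w.2 *
      D2 (obs2 (comb (scale a g) x) (scale a g)) w.2.
have G_le g : G g <= Num.sqrt m1%:R * #|F|%:R ^+ n.
  apply: decode_bound => // i; rewrite ffunE; apply: contra a1 => /eqP/(congr1 val)/= e.
  by apply/eqP; apply: (mulIf (valP (g i))); rewrite mul1r -e.
have le_G : A1 + A2 + A2 - 2 * A0 <= \sum_g c ^+ n * G g.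
  have -> : \sum_g c ^+ n * G g = \sum_w \sum_x \sum_g c ^+ n *
     (E w x * D1 x w.1 * D2 (obs2 (comb g x) g) w.2 *
      D2 (obs2 (comb (scale a g) x) (scale a g)) w.2).
    under [RHS]eq_bigr do rewrite exchange_big/=.
    rewrite [RHS]exchange_big/=; apply: eq_bigr => g _.
    by rewrite mulr_sumr; apply: eq_bigr => w _; rewrite mulr_sumr.
  rewrite {2}A2E' A0E A1E A2E mulr_sumr -!big_split/= -sumrB; apply: ler_sum => w _.
  rewrite mulr_sumr -!big_split/= -sumrB; apply: ler_sum => x _.
  rewrite mulr_sumr -!big_split/= -sumrB; apply: ler_sum => g _.
  have := kernel_le1 x w.1 kD1; have := D10 x w.1.
  have := kernel_le1 (obs2 (comb g x) g) w.2 kD2; have := D20 (obs2 (comb g x) g) w.2.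
  set g' := scale a g.
  have := kernel_le1 (obs2 (comb g' x) g') w.2 kD2; have := D20 (obs2 (comb g' x) g') w.2.
  set u := D1 _ _; set v := D2 (obs2 (comb g x) g) _; set v' := D2 _ _.
  move=> v'0 v'1 v0 v1 u0 u1.
  rewrite [leLHS](_ : _ = c ^+ n * (E w x * (u + v + v' - 2))); last by ring.
  rewrite -!mulrA ler_pM2l//; apply: ler_wpM2l => //.
  (* The two products give [u v v' >= u + v + v' - 2] on [[0, 1]], the union bound for three
     events. *)
  have : 0 <= (1 - v) * (1 - v') by rewrite mulr_ge0 ?subr_ge0.
  have : 0 <= (1 - u) * (1 - v * v') by rewrite mulr_ge0 ?subr_ge0// mulr_ile1.
  lra.
have {le_G} : N * (1 - e1 - 2 * e2) <= Num.sqrt m1%:R * #|F|%:R ^+ n.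
  have -> : N * (1 - e1 - 2 * e2) = A1 + A2 + A2 - 2 * A0 by rewrite h0 h1 h2; ring.
  apply: (le_trans le_G); rewrite -[leRHS]mul1r -[X in X * _](sum_coef R F n) mulr_suml.
  by apply: ler_sum => g _; rewrite ler_pM2l.
set s := Num.sqrt m1%:R.
have s_gt0 : 0 < s by rewrite sqrtr_gt0.
have ss : s * s = m1%:R by rewrite -expr2 sqr_sqrtr// ltW.
rewrite /N -ss -(ler_pM2l s_gt0 _ (#|F|%:R ^+ n)).
have -> // : s * s * m2%:R * (1 - e1 - 2 * e2) = s * ((1 - e1 - 2 * e2) * (m2%:R * s)).
by ring.
Qed.

End Converse.

(** * From message counts to asymptotic rates *)

Section Rates.
Variable R : realType.

Lemma invn_cvg0 : (fun n => n%:R^-1 : R) @ \oo --> (0 : R).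
Proof. by rewrite -(@cvg_shiftS R); exact: cvg_harmonic. Qed.

(** The factor 2 absorbs an error probability bounded away from 1 and costs [n%:R^-1] in the rate,
    which vanishes. The assisted converse takes [s = 0], the classical one [s = 1/2]. *)
Lemma rate_sum_le (q s l1 l2 : R) (m1 m2 : nat -> nat) :
  0 < q ->
  (fun n => n%:R^-1 * log2 (m1 n)%:R) @ \oo --> l1 ->
  (fun n => n%:R^-1 * log2 (m2 n)%:R) @ \oo --> l2 ->
  (\forall n \near \oo, ln (m2 n)%:R + s * ln (m1 n)%:R <= ln (2 * q ^+ n)) ->
  l2 + s * l1 <= log2 q.
Proof.
move=> q_gt0 cl1 cl2 le_q.
have ln2_gt0 : 0 < ln 2 :> R by rewrite ln_gt0// ltr1n.
have cr : (fun n => n%:R^-1 + log2 q) @ \oo --> log2 q.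
  by rewrite -[X in _ --> X]add0r; apply: cvgD; [exact: invn_cvg0|exact: cvg_cst].
have cl : (fun n => n%:R^-1 * log2 (m2 n)%:R + s * (n%:R^-1 * log2 (m1 n)%:R)) @ \oo
    --> l2 + s * l1 by apply: cvgD => //; exact: cvgMl_tmp.
apply: (ler_cvg_to cl cr).
near=> n.
have n_gt0 : (0 : R) < n%:R by rewrite ltr0n; near: n; exact: nbhs_infty_gt.
have : ln (m2 n)%:R + s * ln (m1 n)%:R <= ln (2 * q ^+ n) by near: n.
rewrite lnM ?posrE ?exprn_gt0// lnXn// -[ln q *+ n]mulr_natl => le_n.
rewrite /log2/=.
have -> : n%:R^-1 + ln q / ln 2 = n%:R^-1 * ((ln 2 + n%:R * ln q) / ln 2).
  by field; rewrite !gt_eqF.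
rewrite [leLHS](_ : _ = n%:R^-1 * ((ln (m2 n)%:R + s * ln (m1 n)%:R) / ln 2)).
  by rewrite ler_pM2l ?invr_gt0// ler_pM2r ?invr_gt0.
by ring.
Unshelve. all: by end_near. Qed.

Lemma rate_pow_cvg (q : nat) (k m : nat -> nat) (alpha : R) :
  (0 < q)%N -> (forall n, m n = (q ^ k n)%N) ->
  (fun n => n%:R^-1 * (k n)%:R : R) @ \oo --> alpha ->
  (fun n => n%:R^-1 * log2 ((m n)%:R : R)) @ \oo --> alpha * log2 q%:R.
Proof.
move=> q_gt0 mE ck.
rewrite (_ : (fun n => _) = (fun n => n%:R^-1 * (k n)%:R * log2 q%:R)).
  by apply: cvgMr_tmp.
apply/funext => n; rewrite mE natrX /log2 lnXn ?ltr0n//.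
by rewrite -[ln _ *+ _]mulr_natl !mulrA.
Qed.

Lemma half_cvg : (fun n => n%:R^-1 * (n./2)%:R : R) @ \oo --> (2^-1 : R).
Proof.
(* Rounding [n / 2] down loses at most 1/2, which is below [n%:R^-1] after division by [n]. *)
apply: (@squeeze_cvgr _ _ _ _ (fun n => 2^-1 - n%:R^-1) (fun=> 2^-1)).
- near=> n.
  have n_gt0 : (0 : R) < n%:R by rewrite ltr0n; near: n; exact: nbhs_infty_gt.
  have nE : n%:R = (odd n)%:R + 2 * (n./2)%:R :> R.
    by rewrite -{1}(odd_double_half n) natrD -muln2 natrM [_ * 2]mulrC.
  have o0 : (0 : R) <= (odd n)%:R by exact: ler0n.
  have o1 : (odd n)%:R <= (1 : R) by rewrite lern1 leq_b1.
  rewrite -(ler_pM2l n_gt0) -[X in _ && X](ler_pM2l n_gt0) mulrBr.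
  by rewrite mulrA mulfV ?gt_eqF// mul1r; apply/andP; split; lra.
- by rewrite -[X in _ --> X]subr0; apply: cvgB; [exact: cvg_cst|exact: invn_cvg0].
- exact: cvg_cst.
Unshelve. all: by end_near. Qed.

(** A closed half-plane that contains a set contains its closure, so a converse passes from
    achievable pairs to the capacity region. *)
Lemma closure_rate_le (A : set (R * R)) (s c : R) :
  (forall r, A r -> r.2 + s * r.1 <= c) ->
  forall r, closure A r -> r.2 + s * r.1 <= c.
Proof.
move=> Ac; have cl : closed [set r : R * R | r.2 + s * r.1 <= c].
  apply: (@closed_comp _ _ (fun r : R * R => r.2 + s * r.1) [set x | x <= c]).
    move=> r _; apply: cvgD; first exact: cvg_snd.
    by apply: cvgMl_tmp; exact: cvg_fst.
  exact: closed_le.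
by move=> r /(closureS Ac); rewrite -(proj1 (closure_id _) cl).
Qed.

End Rates.

(** * Outer bounds on the achievable pairs *)

Section CapacityBounds.
Variables (R : realType) (F : finFieldType).

Lemma achievable_NS_le (r : R * R) : achievable_NS F r -> r.2 <= log2 #|F|%:R.
Proof.
have q_gt0 : (0 : R) < #|F|%:R by rewrite ltr0n; apply/card_gt0P; exists 0.
move=> [m1 [m2 [P [NS [m_gt0 [ce [[l1 [cl1 _]] [l2 [cl2 r2]]]]]]]]].
apply: (le_trans r2).
rewrite -[leLHS]addr0 -[X in l2 + X](mul0r l1).
apply: (rate_sum_le q_gt0 cl1 cl2); near=> n.
have [m1_gt0 m2_gt0] := m_gt0 n.
(* An error below 1/2 gives [m2 <= 2 q^n]. *)
have e_lt : Num.max (err1 (P n)) (err2 (P n)) < 1 / 2.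
  by near: n; apply: (cvgr_lt _ ce); lra.
have {e_lt} e2_lt : err2 (P n) < 1 / 2 by move: e_lt; rewrite gt_max => /andP[].
have m2R : (0 : R) < (m2 n)%:R by rewrite ltr0n.
rewrite mul0r addr0 ler_ln ?posrE ?mulr_gt0 ?exprn_gt0//.
have := NS_message_bound m1_gt0 m2_gt0 (NS n); nra.
Unshelve. all: by end_near. Qed.

Lemma achievable_classical_le (r : R * R) : (2 < #|F|)%N ->
  achievable_classical F r -> r.2 + 2^-1 * r.1 <= log2 #|F|%:R.
Proof.
have q_gt0 : (0 : R) < #|F|%:R by rewrite ltr0n; apply/card_gt0P; exists 0.
move=> q_gt2 [m1 [m2 [E [D1 [D2 [ker [m_gt0 [ce [[l1 [cl1 r1]] [l2 [cl2 r2]]]]]]]]]]].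
apply: (@le_trans _ _ (l2 + 2^-1 * l1)); first lra.
apply: (rate_sum_le q_gt0 cl1 cl2); near=> n.
have [m1_gt0 m2_gt0] := m_gt0 n; have [kE [kD1 kD2]] := ker n.
(* Errors below 1/6 make [1 - e1 - 2 e2] exceed 1/2, which matches the factor 2 in [rate_sum_le]. *)
have e_lt : Num.max (err1 (classical_box (E n) (D1 n) (D2 n)))
    (err2 (classical_box (E n) (D1 n) (D2 n))) < 1 / 6.
  by near: n; apply: (cvgr_lt _ ce); lra.
have := classical_message_bound q_gt2 m1_gt0 m2_gt0 kE kD1 kD2.
set B := classical_box _ _ _.
move: e_lt; rewrite -/B gt_max => /andP[e1_lt e2_lt] le_q.
have m1R : (0 : R) < (m1 n)%:R by rewrite ltr0n.
have m2R : (0 : R) < (m2 n)%:R by rewrite ltr0n.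
have s_gt0 : 0 < Num.sqrt (m1 n)%:R :> R by rewrite sqrtr_gt0.
have -> : 2^-1 * ln (m1 n)%:R = ln (Num.sqrt (m1 n)%:R) :> R.
  rewrite -{1}(sqr_sqrtr (ltW m1R)) expr2 lnM ?posrE//; lra.
rewrite -lnM ?posrE// ler_ln ?posrE ?mulr_gt0 ?exprn_gt0//.
have := mulr_gt0 m2R s_gt0; move: le_q; set M := _ * Num.sqrt _; nra.
Unshelve. all: by end_near. Qed.

End CapacityBounds.

(** * Zero-error schemes for the two corner points *)

Section Achievability.
Variables (R : realType) (F : finFieldType).

Lemma zero_error n m1 m2 (P : boxT R F n m1 m2) :
  (forall w g x v1 v2, P w x (obs2 (comb g x) g) x v1 v2 != 0 ->
     v1 = w.1 /\ v2 = w.2) -> err1 P = 0 /\ err2 P = 0.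
Proof.
move=> Pw; split; rewrite /err1 /err2 big1 ?mulr0// => w _; rewrite big1// => y1 _;
  rewrite big1// => y2 _; rewrite big1// => x _; rewrite big1// => v1 _;
  rewrite big1// => v2 _; case: ifPn => // neq; apply/eqP; apply: contraNT neq;
  rewrite mulf_eq0 negb_or chan_nE; case: ifP => [/andP[/eqP -> /eqP ->] /andP[]|];
  rewrite ?eqxx ?andbF//.
  by move=> /Pw[->].
by move=> /Pw[_ ->].
Qed.

Lemma zero_error_good_sequence (m1 m2 : nat -> nat)
    (P : forall n, boxT R F n (m1 n) (m2 n)) (l1 l2 : R) :
  (forall n, (0 < m1 n)%N /\ (0 < m2 n)%N) ->
  (forall n, err1 (P n) = 0 /\ err2 (P n) = 0) ->
  (fun n => n%:R^-1 * log2 (m1 n)%:R) @ \oo --> l1 ->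
  (fun n => n%:R^-1 * log2 (m2 n)%:R) @ \oo --> l2 ->
  good_sequence P (l1, l2).
Proof.
move=> m_gt0 e0 cl1 cl2; split=> //; split; last by split; [exists l1|exists l2].
apply: cvg_near_cst; apply: nearW => n.
by have [-> ->] := e0 n; rewrite maxxx.
Qed.

(** Summing out [b3] leaves [c] on the graph of [f2], which does not involve [a3]; likewise for [b2]
    and [f3]. Summing out [b1] keeps only the unique solution [x0] and leaves the constant [c]. *)
Lemma NSbox_uniform (A1 A2 A3 B1 B2 B3 : finType)
    (f2 : A1 -> A2 -> B1 -> B2) (f3 : A1 -> A3 -> B1 -> B3) (c : R) :
  0 <= c -> c *+ #|B1| = 1 ->
  (forall a1 a2 a3 b2 b3, exists x0, forall x,
     ((b2 == f2 a1 a2 x) && (b3 == f3 a1 a3 x)) = (x == x0)) ->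
  NSbox (fun a1 a2 a3 b1 b2 b3 =>
    if (b2 == f2 a1 a2 b1) && (b3 == f3 a1 a3 b1) then c else 0).
Proof.
move=> c0 c1 uniq_x; set P := fun a1 => _.
have sum3 a1 a2 a3 b1 b2 : \sum_b3 P a1 a2 a3 b1 b2 b3 = if b2 == f2 a1 a2 b1 then c else 0.
  by rewrite /P; case: eqP => _; rewrite ?sum_if_eq// big1.
have sum2 a1 a2 a3 b1 b3 : \sum_b2 P a1 a2 a3 b1 b2 b3 = if b3 == f3 a1 a3 b1 then c else 0.
  under eq_bigr do rewrite /P andbC.
  by case: eqP => _; rewrite ?sum_if_eq// big1.
have sum1 a1 a2 a3 b2 b3 : \sum_b1 P a1 a2 a3 b1 b2 b3 = c.
  by have [x0 x0E] := uniq_x a1 a2 a3 b2 b3; under eq_bigr do rewrite /P x0E;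
    rewrite sum_if_eq.
have sum23 a1 a2 a3 b1 : \sum_b2 \sum_b3 P a1 a2 a3 b1 b2 b3 = c.
  by under eq_bigr do rewrite sum3; rewrite sum_if_eq.
split; split.
- by move=> *; rewrite /P; case: ifP.
- by move=> a1 a2 a3; under eq_bigr do rewrite sum23; rewrite sumr_const.
- by move=> *; rewrite !sum3.
- split; first by move=> *; rewrite !sum2.
  split; first by move=> *; rewrite !sum1.
  split; first by move=> *; rewrite !sum23.
  split=> *; rewrite exchange_big/= [RHS]exchange_big/=;
    by apply: eq_bigr => ? _; rewrite !sum1.
Qed.

Lemma NS_corner : achievable_NS F (log2 (#|F|%:R : R), log2 #|F|%:R).
Proof.
have q_gt0 : (0 < #|F|)%N by apply/card_gt0P; exists 0.
(* Messages are identified with words over the field, so that corrections can be added to them. *)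
pose T n : finType := {ffun 'I_n -> F}.
pose m n := #|{: T n}|.
have mE n : m n = (#|F| ^ n)%N by rewrite /m card_ffun card_ord.
pose fst1 n (y : {ffun 'I_n -> Yout1 F}) : T n := [ffun i => (y i).1].
pose fst2 n (y : {ffun 'I_n -> Yout2 F}) : T n := [ffun i => (y i).1].
pose f1 n (w : 'I_(m n) * 'I_(m n)) (y1 : {ffun 'I_n -> Yout1 F})
    (x : {ffun 'I_n -> Xin F}) : 'I_(m n) :=
  enum_rank (enum_val w.1 + (fst1 n y1 - fst1 n x)).
pose f2 n (w : 'I_(m n) * 'I_(m n)) (y2 : {ffun 'I_n -> Yout2 F})
    (x : {ffun 'I_n -> Xin F}) : 'I_(m n) :=
  enum_rank (enum_val w.2 + (fst2 n y2 - comb (coef y2) x)).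
pose c n : R := (#|{: {ffun 'I_n -> Xin F}}|%:R)^-1.
exists m, m, (fun n w y1 y2 x v1 v2 =>
  if (v1 == f1 n w y1 x) && (v2 == f2 n w y2 x) then c n else 0).
split=> [n|].
  apply: NSbox_uniform; first by rewrite invr_ge0.
    rewrite -mulr_natl mulfV// pnatr_eq0 -lt0n.
    by apply/card_gt0P; exists [ffun=> (0, 0)].
  move=> w y1 y2 v1 v2.
  (* The only input that yields [v1] and [v2]: the first equation determines [x1], and the second
     then [x2]. *)
  pose x1 : T n := enum_val w.1 + fst1 n y1 - enum_val v1.
  pose x2 : T n := [ffun i => (enum_val w.2 + fst2 n y2 - enum_val v2) i -
    val (y2 i).2 * x1 i].
  exists [ffun i => (x1 i, x2 i)] => x; apply/andP/eqP => [[/eqP v1E /eqP v2E]|->].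
    have x1E i : (x i).1 = x1 i.
      by rewrite /x1 v1E enum_rankK !ffunE; ring.
    apply/ffunP => i; rewrite ffunE; apply/eqP; rewrite -pair_eqE/= x1E eqxx/=.
    by rewrite /x2 v2E ffunE -x1E enum_rankK !ffunE; apply/eqP; ring.
  split; apply/eqP; apply: enum_val_inj; rewrite enum_rankK; apply/ffunP => i.
    by rewrite !ffunE/=; ring.
  by rewrite !ffunE/=; ring.
have cvg_m : (fun n => n%:R^-1 * log2 ((m n)%:R : R)) @ \oo --> log2 #|F|%:R.
  rewrite -[X in _ --> X]mul1r; apply: (rate_pow_cvg q_gt0 mE).
  apply: cvg_near_cst; near=> n; rewrite mulVf// pnatr_eq0 -lt0n.
  by near: n; exact: nbhs_infty_gt.
apply: zero_error_good_sequence => // n; first by rewrite mE expn_gt0 q_gt0.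
apply: zero_error => w g x v1 v2; case: ifP; rewrite ?eqxx// => /andP[/eqP -> /eqP ->] _.
have fst2E : fst2 n (obs2 (comb g x) g) = comb (coef (obs2 (comb g x) g)) x.
  by apply/ffunP => i; rewrite !ffunE.
by rewrite /f1 /f2 fst2E !subrr !addr0 !enum_valK.
Unshelve. all: by end_near. Qed.

Lemma dirac_kernel (A B : finType) (f : A -> B) :
  is_kernel (fun a b => if b == f a then 1 else 0 : R).
Proof. by split=> a *; [case: ifP|exact: sum_if_eq]. Qed.

Lemma classical_corner :
  achievable_classical F (log2 (#|F|%:R : R), log2 #|F|%:R / 2).
Proof.
have q_gt0 : (0 < #|F|)%N by apply/card_gt0P; exists 0.
(* [W1] fills both symbols of [n./2] uses, hence rate [log2 q]; [W2] fills one symbol of [n./2]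
   further uses. *)
pose T1 n : finType := {ffun 'I_(n./2) -> F * F}.
pose T2 n : finType := {ffun 'I_(n./2) -> F}.
pose m1 n := #|{: T1 n}|; pose m2 n := #|{: T2 n}|.
have m1E n : m1 n = (#|F| ^ (2 * n./2))%N.
  by rewrite /m1 card_ffun card_prod card_ord mulnn expnM.
have m2E n : m2 n = (#|F| ^ n./2)%N by rewrite /m2 card_ffun card_ord.
have le_half n : (n./2 <= n)%N by rewrite -{2}(odd_double_half n) -addnn addnA leq_addl.
have lt_half n (j : 'I_(n./2)) : (n./2 + j < n)%N.
  have lt_nn : (n./2 + j < n./2 + n./2)%N by rewrite ltn_add2l.
  by apply: (leq_trans lt_nn); rewrite -{3}(odd_double_half n) addnn leq_addl.
pose lo n (j : 'I_(n./2)) : 'I_n := widen_ord (le_half n) j.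
pose hi n (j : 'I_(n./2)) : 'I_n := Ordinal (lt_half n j).
(* The first branch takes all [i] below [n./2], so [i - n./2] is a true difference in the second.
   There [X1 = 0], and Rx-2 reads [X2] whatever the coefficient. For odd [n] the last use is
   idle. *)
pose enc n (w : 'I_(m1 n) * 'I_(m2 n)) : {ffun 'I_n -> Xin F} :=
  [ffun i : 'I_n => if insub (i : nat) is Some j then (enum_val w.1 : T1 n) j
    else if insub (i - n./2)%N is Some j then (0, (enum_val w.2 : T2 n) j)
    else (0, 0)].
pose dec1 n (y : {ffun 'I_n -> Yout1 F}) : 'I_(m1 n) :=
  enum_rank ([ffun j => y (lo n j)] : T1 n).
pose dec2 n (y : {ffun 'I_n -> Yout2 F}) : 'I_(m2 n) :=
  enum_rank ([ffun j => (y (hi n j)).1] : T2 n).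
exists m1, m2, (fun n w x => if x == enc n w then 1 else 0),
  (fun n y v => if v == dec1 n y then 1 else 0),
  (fun n y v => if v == dec2 n y then 1 else 0).
split=> [n|]; first by split; [|split]; exact: dirac_kernel.
apply: zero_error_good_sequence => [n|n||].
- by rewrite m1E m2E !expn_gt0 q_gt0.
- apply: zero_error => w g x v1 v2; rewrite /classical_box.
  case: (x =P enc n w) => [->|]; last by rewrite !mul0r eqxx.
  case: (v1 =P _) => [->|]; last by rewrite mulr0 mul0r eqxx.
  case: (v2 =P _) => [->|]; last by rewrite mulr0 eqxx.
  move=> _; split; rewrite -[RHS]enum_valK; congr enum_rank; apply/ffunP => j.
    by rewrite !ffunE/= valK.
  rewrite !ffunE/= insubN ?addKn ?valK/= ?mulr0 ?add0r//.
  by rewrite -leqNgt leq_addr.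
- rewrite -[X in _ --> X]mul1r; apply: (rate_pow_cvg q_gt0 m1E).
  rewrite (_ : (fun n => _) = (fun n => 2 * (n%:R^-1 * (n./2)%:R))).
    by rewrite -[X in _ --> X](@mulfV _ 2)//; apply: cvgMl_tmp; exact: half_cvg.
  by apply/funext => n; rewrite natrM mulrCA.
- by rewrite [_ / 2]mulrC; apply: (rate_pow_cvg q_gt0 m2E); exact: half_cvg.
Qed.

End Achievability.

Theorem theorem5 (R : realType) (F : finFieldType) :
  (2 < #|F|)%N ->
  is_max_of [set r2 : R | @cap_region_NS R F (log2 (#|F|%:R : R), r2)] (log2 (#|F|%:R : R)) /\
  is_max_of [set r2 : R | @cap_region R F (log2 (#|F|%:R : R), r2)] (log2 (#|F|%:R : R) / 2).
Proof.
move=> q_gt2; split; split=> [|r2 /= cr2].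
- exact/subset_closure/NS_corner.
- have le (r : R * R) : achievable_NS F r -> r.2 + 0 * r.1 <= log2 #|F|%:R.
    by rewrite mul0r addr0; exact: achievable_NS_le.
  by have := closure_rate_le le cr2; rewrite mul0r addr0.
- exact/subset_closure/classical_corner.
- have le (r : R * R) : achievable_classical F r -> r.2 + 2^-1 * r.1 <= log2 #|F|%:R.
    exact: achievable_classical_le.
  (* At first rate [log2 q] the half-plane bound leaves [log2 q / 2] for the second. *)
  by have /= := closure_rate_le le cr2; lra.
Qed.
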